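(* Let $X$ and $Y$ be complex topological vector spaces, let $\Gamma\subset\mathcal{B}(X)$ and $\Gamma_1\subset\mathcal{B}(Y)$, and suppose that $\Gamma$ is quasi-similar to $\Gamma_1$ via a map $\phi: X\to Y$, i.e. $\phi$ is a continuous map with dense range such that for every $T\in\Gamma$ there exists $S\in\Gamma_1$ with $S\circ\phi=\phi\circ T$. If $\Gamma$ is hypercyclic in $X$, then $\Gamma_1$ is hypercyclic in $Y$. Furthermore, $\phi(HC(\Gamma))\subset HC(\Gamma_1)$.
   Context: $\mathcal{B}(X)$ denotes the set of all continuous linear operators on $X$. For $\Gamma\subset\mathcal{B}(X)$ and $x\in X$, $Orb(\Gamma,x)=\{Tx : T\in\Gamma\}$. A vector $x$ is a hypercyclic vector for $\Gamma$ if $Orb(\Gamma,x)$ is dense in $X$; $HC(\Gamma)$ is the set of all hypercyclic vectors for $\Gamma$; $\Gamma$ is hypercyclic (in $X$) if $HC(\Gamma)\neq\emptyset$. The map $\phi$ is not assumed to be linear. *)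

(* Defs.v *)
From mathcomp Require Import all_boot all_algebra.
From mathcomp Require Import boolp classical_sets reals topology tvs.
From mathcomp Require Import complex.
Set Implicit Arguments.
Unset Strict Implicit.
Unset Printing Implicit Defensive.
Import GRing.Theory.

Local Open Scope ring_scope.
Local Open Scope classical_set_scope.

(* Topological vector spaces over [K] are [topologicalLmodType K]: addition,
   opposite and scaling are (jointly) continuous, the scalars [K^o] carrying
   the topology of the norm of [K]. Neither the Hausdorff property nor local
   convexity is part of the structure (the library's [tvsType] is locally
   convex). *)

Section Hypercyclicity.
Context (K : numFieldType).

Definition continuous_operators (X : topologicalLmodType K) : set (X -> X) :=
  [set T | linear T /\ continuous T].

Definition Orb (X : topologicalLmodType K) (Gamma : set (X -> X)) (x : X) :
  set X := [set T x | T in Gamma].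

Definition HC (X : topologicalLmodType K) (Gamma : set (X -> X)) : set X :=
  [set x | dense (Orb Gamma x)].

Definition hypercyclic (X : topologicalLmodType K) (Gamma : set (X -> X)) :
  Prop := HC Gamma !=set0.

(* [phi] is not required to be linear. *)
Definition quasi_similar_via (X Y : topologicalLmodType K)
    (Gamma : set (X -> X)) (Gamma1 : set (Y -> Y)) (phi : X -> Y) : Prop :=
  [/\ continuous phi, dense (range phi) &
      forall T, Gamma T -> exists2 S, Gamma1 S & S \o phi = phi \o T].

End Hypercyclicity.

Arguments continuous_operators {K} X.

(* Main.v *)
Require Import Defs.
From mathcomp Require Import all_boot all_algebra.
From mathcomp Require Import boolp classical_sets reals topology tvs.
From mathcomp Require Import complex.
Local Open Scope ring_scope.
Local Open Scope complex_scope.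
Local Open Scope classical_set_scope.

(** If [x] is hypercyclic for [Gamma], the [phi]-image of its dense orbit is
    dense in [Y], because a continuous map with dense range sends dense sets to
    dense sets ([dense_image]). The intertwining relation [S (phi x) = phi (T x)]
    puts that image inside the orbit of [phi x] under [Gamma1]
    ([image_Orb_subset]), so this larger orbit is dense too: [phi x] is
    hypercyclic for [Gamma1]. The existence of a hypercyclic vector for [Gamma1]
    is then a consequence of the inclusion. *)

(** A nonempty open [O] meets the dense range, so its preimage is a nonempty
    open set, which therefore meets the dense set [D]. *)
Lemma dense_image (T U : topologicalType) (f : T -> U) (D : set T) :
  continuous f -> dense (range f) -> dense D -> dense (f @` D).
Proof.
move=> cf drange dD O O0 oO.
have [y [Oy [x _ fxE]]] := drange O O0 oO.
have preO0 : f @^-1` O !=set0 by exists x; rewrite /preimage /= fxE.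
have preOo : open (f @^-1` O) by move/continuousP: cf; apply.
have [z [Ofz Dz]] := dD _ preO0 preOo.
by exists (f z); split=> //; exists z.
Qed.

Lemma dense_subset (T : topologicalType) (A B : set T) :
  A `<=` B -> dense A -> dense B.
Proof.
move=> AB dA O O0 oO; have [x [Ox Ax]] := dA O O0 oO.
by exists x; split=> //; exact: AB.
Qed.

Lemma image_Orb_subset (K : numFieldType) (X Y : topologicalLmodType K)
    (Gamma : set (X -> X)) (Gamma1 : set (Y -> Y)) (phi : X -> Y) (x : X) :
  quasi_similar_via Gamma Gamma1 phi ->
  phi @` Orb Gamma x `<=` Orb Gamma1 (phi x).
Proof.
move=> [_ _ intertwine] _ [_ [T GT <-] <-].
have [S GS Sphi] := intertwine T GT.
by exists S => //; exact: (congr1 (@^~ x) Sphi).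
Qed.

Theorem proposition2p5 (R : realType) (X Y : topologicalLmodType R[i])
    (Gamma : set (X -> X)) (Gamma1 : set (Y -> Y)) (phi : X -> Y)
    (GammaX : Gamma `<=` continuous_operators X)
    (Gamma1Y : Gamma1 `<=` continuous_operators Y)
    (Gamma_phi_Gamma1 : quasi_similar_via Gamma Gamma1 phi) :
  (hypercyclic Gamma -> hypercyclic Gamma1) /\ phi @` HC Gamma `<=` HC Gamma1.
Proof.
have HCsub : phi @` HC Gamma `<=` HC Gamma1.
  move=> _ [x HCx <-]; have [cphi dphi _] := Gamma_phi_Gamma1.
  apply: (dense_subset _ _ _ (image_Orb_subset _ _ _ _ _ _ x Gamma_phi_Gamma1)).
  exact: dense_image.
split=> // -[x HCx]; exists (phi x).
by apply: HCsub; exists x.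
Qed.
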